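(* Let $A\in\mathbb{R}^{m\times n}$ ($m\ll n$), let $k$ be a positive integer, and let $y:=Ax+\eta$, where $x\in\mathbb{R}^n$ is $k$-compressible, $\eta\in\mathbb{R}^m$ and $S=\mathcal{L}_k(x)$. Let $q\ge k$ be a positive integer and let $\varphi=\frac{\sqrt5+1}{2}$. Suppose that the restricted isometry constants of $A$ satisfy $$\delta_{\max\{q,3k\}}<\frac{-(2\varphi+1)+\sqrt{(2\varphi+1)^2+4\varphi\sqrt{\lceil\frac nk\rceil}}}{2\varphi\sqrt{\lceil\frac nk\rceil}}.$$ Let $\lambda$ be chosen such that $$(1+\delta_q)\left(1-\frac{\frac1\varphi\sqrt{1-\delta_{2k}^2}-\delta_{3k}}{1+\sqrt{\lceil\frac nk\rceil}\,\delta_{3k}}\right)<\lambda<(1-\delta_q)\left(1+\frac{\frac1\varphi\sqrt{1-\delta_{2k}^2}-\delta_{3k}}{1+\sqrt{\lceil\frac nk\rceil}\,\delta_{3k}}\right),$$ and let the parameters $\alpha,\gamma>0$ satisfy $\frac1{1+\delta_q}\le\alpha\gamma\le\frac1{1-\delta_q}$. Then the sequence $\{x^{(p)}\}$ generated by the CNHTP algorithm (with input $A,y,k,q,\lambda,\alpha,\gamma$) satisfies, for every $p\ge0$, $$\|x^{(p+1)}-x_S\|_2\le\rho_2\|x^{(p)}-x_S\|_2+\left(\frac{\lambda\varphi}{1-\delta_q}\sqrt{\frac{\lceil\frac nk\rceil(1+\delta_k)}{1-\delta_{2k}^2}}+\frac{\sqrt{1+\delta_k}}{1-\delta_{2k}}\right)\|\eta'\|_2,$$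 where $\eta'=Ax_{\overline S}+\eta$, $$\rho_2:=\frac{\varphi}{\sqrt{1-\delta_{2k}^2}}\left(\delta_{3k}+\Delta(\lambda,\delta_q)\left(1+\sqrt{\lceil\tfrac nk\rceil}\,\delta_{3k}\right)\right),\qquad \Delta(\lambda,\delta_q):=\max\left\{\left|1-\tfrac{\lambda}{1-\delta_q}\right|,\left|1-\tfrac{\lambda}{1+\delta_q}\right|\right\},$$ and $\rho_2<1$. Moreover, $\{x^{(p)}\}$ converges to $x_S$ when $\eta'=0$.
   Context: Restricted isometry constant: for a positive integer $t$, $\delta_t$ is the smallest $\delta\in[0,1)$ such that $(1-\delta)\|z\|_2^2\le\|Az\|_2^2\le(1+\delta)\|z\|_2^2$ for all $t$-sparse $z\in\mathbb{R}^n$ (vectors with at most $t$ nonzero entries); a bound on $\delta_t$ includes the requirement that such a constant exists. Note that $\delta_t$ is nondecreasing in $t$. Notation: $\mathcal{H}_k(z)$ keeps the $k$ largest-magnitude entries of $z$ and sets the others to zero (ties broken by any fixed rule); $\mathcal{L}_k(z)$ is the support of $\mathcal{H}_k(z)$. For an index set $\Omega\subseteq\{1,\dots,n\}$, $\overline\Omega$ is its complement, $A_\Omega$ is the submatrix of columns of $A$ indexed by $\Omega$, and for a vector $x$, $x_\Omega\in\mathbb{R}^n$ (used as an argument of $A$ or compared with vectors in $\mathbb{R}^n$) equals $x$ on $\Omega$ and is zero elsewhere. Thus $x_S$ is the best $k$-term approximation of $x$. ''$k$-compressible'' is an informal term (well approximated by a $k$-sparse vector, not necessarily exactly $k$-sparse)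 and imposes no quantitative condition on $x$. For $\Omega\subseteq\{1,\dots,n\}$ and parameters $\alpha,\gamma>0$: $M(\Omega)\in\mathbb{R}^{n\times n}$ is the matrix with principal submatrix $M(\Omega)_{\Omega\times\Omega}=(A_\Omega^\top A_\Omega)^{-1}$, diagonal entries $[M(\Omega)]_{ii}=\alpha$ for $i\notin\Omega$, and all other entries zero; $Z(\Omega)=\operatorname{diag}(z_1,\dots,z_n)$ with $z_i=1$ for $i\in\Omega$ and $z_i=\gamma$ for $i\notin\Omega$. CNHTP algorithm (compressed Newton-direction-based thresholding pursuit): start from $x^{(0)}=\mathbf 0$. For $p=0,1,2,\dots$: let $\Omega^p=\mathcal{L}_q(A^\top(y-Ax^{(p)}))$, set $u^{(p)}=x^{(p)}+\lambda M(\Omega^p)Z(\Omega^p)A^\top(y-Ax^{(p)})$, $S^{(p+1)}=\operatorname{supp}(\mathcal{H}_k(u^{(p)}))$, and $x^{(p+1)}=\arg\min_z\{\|y-Az\|_2^2:\operatorname{supp}(z)\subseteq S^{(p+1)}\}$. *)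

(* Defs.v *)
From HB Require Import structures.
From mathcomp Require Import all_boot all_order all_algebra.
From mathcomp Require Import all_classical all_reals all_analysis.

Set Implicit Arguments.
Unset Strict Implicit.
Unset Printing Implicit Defensive.

Import Order.TTheory GRing.Theory Num.Theory.
Import numFieldNormedType.Exports.

Local Open Scope ring_scope.

(* The norm `|z| of the library on matrices is the max norm. *)
Definition norm2 (R : realType) (n : nat) (z : 'cV[R]_n) : R :=
  Num.sqrt (\sum_i z i 0 ^+ 2).

Definition supp (R : realType) (n : nat) (z : 'cV[R]_n) : {set 'I_n} :=
  [set i | z i 0 != 0].

Definition sparse (R : realType) (n t : nat) (z : 'cV[R]_n) : Prop :=
  (#|supp z| <= t)%N.

Definition restr_vec (R : realType) (n : nat) (O : {set 'I_n}) (z : 'cV[R]_n) :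
    'cV[R]_n :=
  \col_i (if i \in O then z i 0 else 0).

Definition rip (R : realType) (m n : nat) (A : 'M[R]_(m, n)) (t : nat) (d : R) :
    Prop :=
  0 <= d < 1 /\
  forall z : 'cV[R]_n, sparse t z ->
    (1 - d) * norm2 z ^+ 2 <= norm2 (A *m z) ^+ 2 <= (1 + d) * norm2 z ^+ 2.

Definition is_ric (R : realType) (m n : nat) (A : 'M[R]_(m, n)) (t : nat)
    (d : R) : Prop :=
  rip A t d /\ forall e, rip A t e -> d <= e.

(* The constant delta_t. The default value 0 is meaningless, so a bound on
   [ric A t] must come with [exists d, is_ric A t d]. *)
Definition ric (R : realType) (m n : nat) (A : 'M[R]_(m, n)) (t : nat) : R :=
  xget 0 (is_ric A t : set R).

(* A fixed tie-breaking rule: [T k z] is a choice of min(k, n) positions at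
   which z is largest in magnitude. *)
Definition topk_rule (R : realType) (n : nat)
    (T : nat -> 'cV[R]_n -> {set 'I_n}) : Prop :=
  forall k z, #|T k z| = minn k n /\
    forall i j, i \in T k z -> j \notin T k z -> `|z j 0| <= `|z i 0|.

Definition Hthr (R : realType) (n : nat) (T : nat -> 'cV[R]_n -> {set 'I_n})
    (k : nat) (z : 'cV[R]_n) : 'cV[R]_n := restr_vec (T k z) z.

(* This can be a proper subset of [T k z], when z has fewer than k nonzero
   entries. *)
Definition Lthr (R : realType) (n : nat) (T : nat -> 'cV[R]_n -> {set 'I_n})
    (k : nat) (z : 'cV[R]_n) : {set 'I_n} := supp (Hthr T k z).

Definition cols (R : realType) (m n : nat) (A : 'M[R]_(m, n)) (O : {set 'I_n}) :
    'M[R]_(m, #|O|) :=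
  colsub (fun a : 'I_#|O| => enum_val a) A.

Definition rank_of (n : nat) (O : {set 'I_n}) (i : 'I_n) : option 'I_#|O| :=
  [pick a | enum_val a == i].

Definition Mmx (R : realType) (m n : nat) (A : 'M[R]_(m, n)) (alpha : R)
    (O : {set 'I_n}) : 'M[R]_n :=
  \matrix_(i, j)
    match rank_of O i, rank_of O j with
    | Some a, Some b => invmx ((cols A O)^T *m cols A O) a b
    | None, None => if i == j then alpha else 0
    | _, _ => 0
    end.

Definition Zmx (R : realType) (n : nat) (gamma : R) (O : {set 'I_n}) :
    'M[R]_n :=
  diag_mx (\row_i (if i \in O then 1 else gamma)).

Definition is_argmin_on (R : realType) (m n : nat) (A : 'M[R]_(m, n))
    (y : 'cV[R]_m) (S : {set 'I_n}) (w : 'cV[R]_n) : Prop :=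
  supp w \subset S /\
  forall z : 'cV[R]_n, supp z \subset S ->
    norm2 (y - A *m w) ^+ 2 <= norm2 (y - A *m z) ^+ 2.

Definition cnhtp_u (R : realType) (m n : nat)
    (T : nat -> 'cV[R]_n -> {set 'I_n}) (A : 'M[R]_(m, n)) (y : 'cV[R]_m)
    (q : nat) (lambda alpha gamma : R) (w : 'cV[R]_n) : 'cV[R]_n :=
  let r := A^T *m (y - A *m w) in
  let O := Lthr T q r in
  w + lambda *: (Mmx A alpha O *m Zmx gamma O *m r).

Definition cnhtp (R : realType) (m n : nat)
    (T : nat -> 'cV[R]_n -> {set 'I_n}) (A : 'M[R]_(m, n)) (y : 'cV[R]_m)
    (k q : nat) (lambda alpha gamma : R) (xs : nat -> 'cV[R]_n) : Prop :=
  xs 0%N = 0 /\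
  forall p, is_argmin_on A y
    (Lthr T k (cnhtp_u T A y q lambda alpha gamma (xs p))) (xs p.+1).

Definition golden (R : realType) : R := (Num.sqrt 5 + 1) / 2.

(* The real number ceil(n / k). *)
Definition ceil_div (R : realType) (n k : nat) : R :=
  (Num.ceil (n%:R / k%:R : R))%:~R.

Definition Delta (R : realType) (lambda d : R) : R :=
  Num.max `|1 - lambda / (1 - d)| `|1 - lambda / (1 + d)|.

(* Main.v *)
(* Write [v = x_S - x^p], [P = M Z] and [u = u^(p)]. Then
     [x_S - u = (v - A^T A v) + (1 - lambda P) A^T A v - lambda P A^T eta'].
   [P] is symmetric and its quadratic form lies between [1/(1 + delta_q)] and
   [1/(1 - delta_q)], so polarization bounds [1 - lambda P] by
   [Delta lambda delta_q]; the RIP bounds [v - A^T A v] on small index sets,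
   hence globally, at the price of a factor [sqrt (ceil (n / k))], by cutting
   the indices into blocks of size [k]. Comparing the entries that hard
   thresholding drops with those it keeps gives
   [|(x_S) off S^(p+1)| <= sqrt 2 |(x_S - u) on S and S^(p+1)|], and
   [sqrt 2 <= phi]. The normal equations of the least-squares step turn this
   into a bound on [x^(p+1) - x_S]. Finally [rho2 < 1] amounts to [Delta < tau],
   which is what the range of [lambda] says. *)
Require Import Defs.
From HB Require Import structures.
From mathcomp Require Import all_boot all_order all_algebra.
From mathcomp Require Import all_classical all_reals all_analysis.
From mathcomp Require Import ring lra zify.

Set Implicit Arguments.
Unset Strict Implicit.
Unset Printing Implicit Defensive.

Import Order.TTheory GRing.Theory Num.Theory.
Import numFieldNormedType.Exports.

Local Open Scope classical_set_scope.
Local Open Scope ring_scope.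

(** * Inner product, Euclidean norm, and restriction of vectors to index sets *)

Definition dot (R : realType) (n : nat) (u v : 'cV[R]_n) : R := (u^T *m v) 0 0.

Section Euclid.
Variable R : realType.
Implicit Types (m n : nat).

Lemma dotE n (u v : 'cV[R]_n) : dot u v = \sum_i u i 0 * v i 0.
Proof. by rewrite /dot mxE; apply: eq_bigr => i _; rewrite mxE. Qed.

Lemma dotC n (u v : 'cV[R]_n) : dot u v = dot v u.
Proof. by rewrite !dotE; apply: eq_bigr => i _; rewrite mulrC. Qed.

Lemma dotDr n (u v w : 'cV[R]_n) : dot u (v + w) = dot u v + dot u w.
Proof. by rewrite /dot mulmxDr mxE. Qed.

Lemma dotZr n a (u v : 'cV[R]_n) : dot u (a *: v) = a * dot u v.
Proof. by rewrite /dot -scalemxAr mxE. Qed.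

Lemma dotBr n (u v w : 'cV[R]_n) : dot u (v - w) = dot u v - dot u w.
Proof. by rewrite -scaleN1r dotDr dotZr mulN1r. Qed.

Lemma dotDl n (u v w : 'cV[R]_n) : dot (u + v) w = dot u w + dot v w.
Proof. by rewrite dotC dotDr !(dotC w). Qed.

Lemma dotZl n a (u v : 'cV[R]_n) : dot (a *: u) v = a * dot u v.
Proof. by rewrite dotC dotZr dotC. Qed.

Lemma dotBl n (u v w : 'cV[R]_n) : dot (u - v) w = dot u w - dot v w.
Proof. by rewrite dotC dotBr !(dotC w). Qed.

Lemma dot0l n (v : 'cV[R]_n) : dot 0 v = 0.
Proof. by rewrite /dot trmx0 mul0mx mxE. Qed.

Lemma dot_mulmxl m n (A : 'M[R]_(m, n)) u v : dot (A *m u) v = dot u (A^T *m v).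
Proof. by rewrite /dot trmx_mul mulmxA. Qed.

Lemma norm2_ge0 n (z : 'cV[R]_n) : 0 <= norm2 z.
Proof. exact: sqrtr_ge0. Qed.

Lemma norm2_sqr n (z : 'cV[R]_n) : norm2 z ^+ 2 = dot z z.
Proof.
rewrite /norm2 sqr_sqrtr; last by apply: sumr_ge0 => i _; exact: sqr_ge0.
by rewrite dotE; apply: eq_bigr => i _; rewrite expr2.
Qed.

Lemma coord_norm2 n (z : 'cV[R]_n) i : `|z i 0| <= norm2 z.
Proof.
rewrite -sqrtr_sqr; apply: ler_wsqrtr; rewrite (bigD1 i) //= lerDl.
by apply: sumr_ge0 => j _; exact: sqr_ge0.
Qed.

Lemma norm2_eq0 n (z : 'cV[R]_n) : norm2 z = 0 -> z = 0.
Proof.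
move=> z0; apply/colP => i; rewrite mxE; apply/eqP.
by rewrite -normr_le0 -z0 coord_norm2.
Qed.

(** Cauchy-Schwarz: the squared norm of [norm2 v *: u - norm2 u *: v] is
    [2 |u| |v| (|u| |v| - dot u v)], and the factor in front is positive once both vectors are
    nonzero. *)
Lemma dot_le n (u v : 'cV[R]_n) : dot u v <= norm2 u * norm2 v.
Proof.
have [u0|u0] := eqVneq (norm2 u) 0.
  by rewrite u0 mul0r (norm2_eq0 u0) dot0l.
have [v0|v0] := eqVneq (norm2 v) 0.
  by rewrite v0 mulr0 (norm2_eq0 v0) dotC dot0l.
have p : 0 < 2 * (norm2 u * norm2 v).
  by rewrite mulr_gt0 // mulr_gt0 // lt0r ?u0 ?v0 norm2_ge0.
have := sqr_ge0 (norm2 (norm2 v *: u - norm2 u *: v)).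
rewrite norm2_sqr !(dotBl, dotBr, dotZl, dotZr) -!norm2_sqr (dotC v u) => h.
rewrite -subr_ge0 -(pmulr_rge0 _ p); apply: le_trans h _.
by rewrite le_eqVlt; apply/orP; left; apply/eqP; ring.
Qed.

Lemma norm2_le n (z : 'cV[R]_n) b : 0 <= b -> norm2 z ^+ 2 <= b ^+ 2 -> norm2 z <= b.
Proof. by move=> b0; rewrite ler_pXn2r // nnegrE norm2_ge0. Qed.

Lemma norm2Z n a (z : 'cV[R]_n) : norm2 (a *: z) = `|a| * norm2 z.
Proof.
apply: (@pexpIrn _ 2) => //; rewrite ?nnegrE ?norm2_ge0 ?mulr_ge0 ?norm2_ge0 //.
by rewrite exprMn !norm2_sqr dotZl dotZr mulrA -expr2 real_normK // num_real.
Qed.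

Lemma norm2D n (u v : 'cV[R]_n) : norm2 (u + v) <= norm2 u + norm2 v.
Proof.
apply: norm2_le; first by rewrite addr_ge0 ?norm2_ge0.
rewrite norm2_sqr !(dotDl, dotDr) -!norm2_sqr (dotC v u).
by have := dot_le u v; lra.
Qed.

Lemma norm2B_sqr n (u v : 'cV[R]_n) :
  norm2 (u - v) ^+ 2 = norm2 u ^+ 2 - 2 * dot v u + norm2 v ^+ 2.
Proof. by rewrite !norm2_sqr !(dotBl, dotBr) (dotC u v); ring. Qed.

Lemma norm2B n (u v : 'cV[R]_n) : norm2 (u - v) <= norm2 u + norm2 v.
Proof.
by rewrite -scaleN1r (le_trans (norm2D _ _)) // norm2Z normrN1 mul1r.
Qed.

Lemma norm2C n (u v : 'cV[R]_n) : norm2 (u - v) = norm2 (v - u).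
Proof. by rewrite -opprB -scaleN1r norm2Z normrN1 mul1r. Qed.

Lemma restr_vecB n O (u v : 'cV[R]_n) :
  restr_vec O (u - v) = restr_vec O u - restr_vec O v.
Proof. by apply/colP => i; rewrite !mxE; case: ifP => // _; rewrite subr0. Qed.

Lemma restr_vecD n O (u v : 'cV[R]_n) :
  restr_vec O (u + v) = restr_vec O u + restr_vec O v.
Proof. by apply/colP => i; rewrite !mxE; case: ifP => // _; rewrite addr0. Qed.

Lemma restr_vec_id n (O : {set 'I_n}) (z : 'cV[R]_n) :
  supp z \subset O -> restr_vec O z = z.
Proof.
move=> /fintype.subsetP sO; apply/colP => i; rewrite mxE; case: ifP => // iO.
by apply/esym/eqP/negPn/negP => zi; rewrite (sO i) // inE in iO.
Qed.

Lemma dot_restr n O (u v : 'cV[R]_n) :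
  dot (restr_vec O u) v = \sum_(i in O) u i 0 * v i 0.
Proof.
rewrite dotE [RHS]big_mkcond /=; apply: eq_bigr => i _; rewrite mxE.
by case: ifP => // _; rewrite mul0r.
Qed.

Lemma norm2_restr_sqr n O (z : 'cV[R]_n) :
  norm2 (restr_vec O z) ^+ 2 = \sum_(i in O) z i 0 ^+ 2.
Proof.
rewrite norm2_sqr dot_restr; apply: eq_bigr => i iO.
by rewrite mxE iO expr2.
Qed.

Lemma dot_restr_norm2 n O (z : 'cV[R]_n) :
  dot (restr_vec O z) z = norm2 (restr_vec O z) ^+ 2.
Proof.
by rewrite dot_restr norm2_restr_sqr; apply: eq_bigr => i _; rewrite expr2.
Qed.

Lemma norm2_restr_le n O (z : 'cV[R]_n) : norm2 (restr_vec O z) <= norm2 z.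
Proof.
apply: norm2_le (norm2_ge0 _) _; rewrite norm2_restr_sqr norm2_sqr dotE.
rewrite [leRHS](bigID (mem O)) /=.
under [X in _ <= X + _]eq_bigr do rewrite -expr2.
by rewrite lerDl; apply: sumr_ge0 => i _; rewrite -expr2 sqr_ge0.
Qed.

Lemma norm2_splitC n O (z : 'cV[R]_n) :
  norm2 z ^+ 2 = norm2 (restr_vec O z) ^+ 2 + norm2 (restr_vec (~: O)%SET z) ^+ 2.
Proof.
rewrite !norm2_restr_sqr norm2_sqr dotE (bigID (mem O)) /=.
by congr (_ + _); apply: eq_big => i; rewrite ?inE // expr2.
Qed.

Lemma supp_restr n (O : {set 'I_n}) (z : 'cV[R]_n) : supp (restr_vec O z) \subset O.
Proof.
by apply/fintype.subsetP => i; rewrite inE mxE; case: ifP => //; rewrite eqxx.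
Qed.

Lemma suppD n (O : {set 'I_n}) (u v : 'cV[R]_n) :
  supp u \subset O -> supp v \subset O -> supp (u + v) \subset O.
Proof.
move=> /restr_vec_id uO /restr_vec_id vO.
by rewrite -uO -vO -restr_vecD supp_restr.
Qed.

Lemma suppZ n (O : {set 'I_n}) a (u : 'cV[R]_n) :
  supp u \subset O -> supp (a *: u) \subset O.
Proof.
move=> /restr_vec_id <-; apply/fintype.subsetP => i; rewrite inE !mxE.
by case: ifP => //; rewrite mulr0 eqxx.
Qed.

Lemma suppB n (O : {set 'I_n}) (u v : 'cV[R]_n) :
  supp u \subset O -> supp v \subset O -> supp (u - v) \subset O.
Proof. by move=> uO vO; rewrite -scaleN1r suppD // suppZ. Qed.

(* Polarization at [|v| u + |u| v] and [|v| u - |u| v]. *)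
Lemma sym_form_le n (K : 'M[R]_n) (O : {set 'I_n}) d :
  K^T = K ->
  (forall z, supp z \subset O -> `|dot z (K *m z)| <= d * norm2 z ^+ 2) ->
  forall u v, supp u \subset O -> supp v \subset O ->
  dot u (K *m v) <= d * (norm2 u * norm2 v).
Proof.
move=> Ksym Kd u v uO vO.
have [u0|u0] := eqVneq (norm2 u) 0.
  by rewrite u0 mul0r mulr0 (norm2_eq0 u0) dot0l.
have [v0|v0] := eqVneq (norm2 v) 0.
  by rewrite v0 !mulr0 (norm2_eq0 v0) mulmx0 dotC dot0l.
have p : 0 < 4 * (norm2 u * norm2 v).
  by rewrite mulr_gt0 // mulr_gt0 // lt0r ?u0 ?v0 norm2_ge0.
have Kvu : dot v (K *m u) = dot u (K *m v).
  by rewrite -{1}Ksym -dot_mulmxl dotC.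
have := Kd (norm2 v *: u + norm2 u *: v) (suppD (suppZ _ uO) (suppZ _ vO)).
have := Kd (norm2 v *: u - norm2 u *: v) (suppB (suppZ _ uO) (suppZ _ vO)).
rewrite !norm2_sqr !(mulmxBr, mulmxDr) -!scalemxAr.
rewrite !(dotBl, dotBr, dotDl, dotDr, dotZl, dotZr) -!norm2_sqr Kvu (dotC v u).
rewrite !ler_norml => /andP[h1 _] /andP[_ h2].
rewrite -(ler_pM2l p); lra.
Qed.

(** Pair [K *m v] with its own restriction [w]: the pairing is [norm2 w ^+ 2], the bilinear bound
    applies because [w] is supported in [O], and one factor [norm2 w] cancels. *)
Lemma sym_form_norm2 n (K : 'M[R]_n) (O V : {set 'I_n}) d :
  0 <= d -> K^T = K ->
  (forall z, supp z \subset O -> `|dot z (K *m z)| <= d * norm2 z ^+ 2) ->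
  forall v, supp v \subset O -> V \subset O ->
  norm2 (restr_vec V (K *m v)) <= d * norm2 v.
Proof.
move=> d0 Ksym Kd v vO VO; set w := restr_vec V _.
have wO : supp w \subset O := fintype.subset_trans (supp_restr _ _) VO.
have := sym_form_le Ksym Kd wO vO; rewrite dot_restr_norm2 -/w.
have [w0|w0] := eqVneq (norm2 w) 0; first by rewrite w0 mulr_ge0 ?norm2_ge0.
by rewrite expr2 mulrCA ler_pM2l // lt0r w0 norm2_ge0.
Qed.

End Euclid.

(** * Restricted isometry constants, their consequences, and Gram matrices *)

Section RestrictedIsometry.
Variable R : realType.
Implicit Types (m n : nat).

(** The infimum is attained because each sparse [z] with [N = |z|^2 > 0] and [M = |A z|^2]
    constrains [d] only by the closed conditions [1 - M / N <= d] and [M / N - 1 <= d], which pass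
    to the infimum. Hence [ric] takes a genuine value as soon as one admissible constant exists. *)
Lemma rip_inf m n (A : 'M[R]_(m, n)) t :
  (exists d, rip A t d) -> is_ric A t (inf (rip A t : set R)).
Proof.
move=> [d0 rd0]; set E : set R := rip A t; set e := inf E.
have lbE : has_lbound E by exists 0 => d [/andP[]].
have eE d : E d -> e <= d by exact: ge_inf.
have leE b : (forall d, E d -> b <= d) -> b <= e by apply: lb_le_inf; exists d0.
split; last exact: eE.
split.
  apply/andP; split; first by apply: leE => d [/andP[]].
  by apply: le_lt_trans (eE _ rd0) _; case: rd0 => /andP[].
move=> z tz; have [z0|z0] := eqVneq (norm2 z) 0.
  have [_ /(_ z tz)] := rd0.
  by rewrite z0 expr0n /= !mulr0.
have p : 0 < norm2 z ^+ 2 by rewrite exprn_gt0 // lt0r z0 norm2_ge0.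
set N := norm2 z ^+ 2 in p *; set M := norm2 (A *m z) ^+ 2.
have lo : 1 - M / N <= e.
  apply: leE => d [_ /(_ z tz) /andP[h _]].
  by rewrite lerBlDr addrC -lerBlDr ler_pdivlMr.
have hi : M / N - 1 <= e.
  apply: leE => d [_ /(_ z tz) /andP[_ h]].
  by rewrite lerBlDr addrC ler_pdivrMr.
apply/andP; split.
  by rewrite -ler_pdivlMr //; lra.
by rewrite -ler_pdivrMr //; lra.
Qed.

Lemma ricP m n (A : 'M[R]_(m, n)) t :
  (exists d, rip A t d) -> rip A t (ric A t).
Proof.
move=> /rip_inf ex; have : is_ric A t (ric A t) by apply: xgetPex; eexists; exact: ex.
by case.
Qed.

Lemma rip_le m n (A : 'M[R]_(m, n)) t s d : (s <= t)%N -> rip A t d -> rip A s d.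
Proof. by move=> st [d01 h]; split => // z zs; apply: h; exact: leq_trans st. Qed.

(** The symmetric matrix [1 - A^T A] has quadratic form [|z|^2 - |A z|^2], which the RIP bounds by
    [d |z|^2] for [z] supported in [O]. *)
Lemma rip_defect m n (A : 'M[R]_(m, n)) t d (O V : {set 'I_n}) v :
  rip A t d -> (#|O| <= t)%N -> supp v \subset O -> V \subset O ->
  norm2 (restr_vec V (v - A^T *m (A *m v))) <= d * norm2 v.
Proof.
move=> [/andP[d0 _] h] Ot vO VO.
have -> : v - A^T *m (A *m v) = (1%:M - A^T *m A) *m v.
  by rewrite mulmxBl mul1mx mulmxA.
apply: sym_form_norm2 vO VO => //.
  by rewrite linearB /= trmx1 trmx_mul trmxK.
move=> z zO; have /h : sparse t z by apply: leq_trans Ot; exact: subset_leq_card.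
rewrite mulmxBl mul1mx dotBr -norm2_sqr -mulmxA -dot_mulmxl -norm2_sqr.
by rewrite ler_norml => /andP[h1 h2]; apply/andP; split; lra.
Qed.

Lemma rip_norm2 m n (A : 'M[R]_(m, n)) t d z :
  rip A t d -> sparse t z -> norm2 (A *m z) <= Num.sqrt (1 + d) * norm2 z.
Proof.
move=> [/andP[d0 _] h] /h/andP[_ hz].
apply: norm2_le; first by rewrite mulr_ge0 ?sqrtr_ge0 ?norm2_ge0.
by rewrite exprMn (sqr_sqrtr (addr_ge0 ler01 d0)).
Qed.

(** Dual to [rip_norm2]: pair the restriction [w] with itself and move [A^T] across, so that
    [|w|^2 = dot (A w) r] with [w] sparse. *)
Lemma rip_trmx m n (A : 'M[R]_(m, n)) t d (V : {set 'I_n}) r :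
  rip A t d -> (#|V| <= t)%N ->
  norm2 (restr_vec V (A^T *m r)) <= Num.sqrt (1 + d) * norm2 r.
Proof.
move=> Ad Vt; set w := restr_vec V _.
have wt : sparse t w by apply: leq_trans Vt; rewrite subset_leq_card ?supp_restr.
have [w0|w0] := eqVneq (norm2 w) 0.
  by rewrite w0 mulr_ge0 ?sqrtr_ge0 ?norm2_ge0.
have wp : 0 < norm2 w by rewrite lt0r w0 norm2_ge0.
rewrite -(ler_pM2l wp) -expr2 -dot_restr_norm2 -/w -dot_mulmxl.
apply: le_trans (dot_le _ _) _.
rewrite mulrA (mulrC (norm2 w)); apply: ler_wpM2r; first exact: norm2_ge0.
exact: rip_norm2 Ad wt.
Qed.

(* Cut the indices into at most [ceil (n / k)] blocks of at most [k] elements. *)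
Lemma norm2_blocks n k (z : 'cV[R]_n) b : (0 < k)%N -> (0 < n)%N -> 0 <= b ->
  (forall V : {set 'I_n}, (#|V| <= k)%N -> norm2 (restr_vec V z) <= b) ->
  norm2 z <= Num.sqrt (ceil_div R n k) * b.
Proof.
(* For positive [n], the quotients [i %/ k] with [i < n] take exactly [(n.-1 %/ k).+1] values. *)
move=> k0 n0 b0 zb; set N := ((n.-1 %/ k).+1)%N.
have Nc : N%:R <= ceil_div R n k.
  have -> : N%:R = (N%:Z)%:~R :> R by [].
  rewrite /ceil_div ler_int.
  have -> : N%:Z = (n.-1 %/ k)%N%:Z + 1 by rewrite /N -addn1 PoszD.
  rewrite lezD1 Num.Theory.ceil_gt_int.
  rewrite ltr_pdivlMr ?ltr0n // -[_%:~R]/((n.-1 %/ k)%:R) -natrM ltr_nat.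
  by apply: leq_ltn_trans (leq_divM _ _) _; rewrite prednK.
have c0 : 0 <= ceil_div R n k by apply: le_trans Nc; rewrite ler0n.
apply: norm2_le; first by rewrite mulr_ge0 ?sqrtr_ge0.
rewrite exprMn (sqr_sqrtr c0).
have blk (i : 'I_n) : (i %/ k < N)%N.
  by rewrite ltnS leq_div2r // -ltnS prednK.
pose f i : 'I_N := Ordinal (blk i).
rewrite norm2_sqr dotE (partition_big f xpredT) //=.
apply: (@le_trans _ _ (\sum_(j < N) b ^+ 2)); last first.
  rewrite sumr_const card_ord -mulr_natl; apply: ler_wpM2r => //.
  exact: sqr_ge0.
apply: ler_sum => j _; pose V := [set i | f i == j]%SET.
have -> : \sum_(i | f i == j) z i 0 * z i 0 = norm2 (restr_vec V z) ^+ 2.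
  by rewrite norm2_restr_sqr; apply: eq_big => i; rewrite ?inE // expr2.
rewrite ler_pXn2r // ?nnegrE ?norm2_ge0 //; apply: zb.
(* Within one block the residue modulo [k] determines the index, so the block has at most [k]
   elements. *)
pose g (i : 'I_n) : 'I_k := Ordinal (ltn_pmod i k0).
rewrite -[leqRHS]card_ord -(@card_in_imset _ _ g); first exact: max_card.
move=> i i'; rewrite !inE => /eqP ij /eqP i'j /(congr1 val) /= gi.
apply: val_inj; rewrite /= (divn_eq i k) (divn_eq i' k) gi.
by move: (etrans ij (esym i'j)) => /(congr1 val) /= ->.
Qed.

(** The lower bound makes [C] injective, and a vector killed by [C^T C] is killed by [C], since
    [|C w|^2 = dot w (C^T C w)]. *)
Lemma gram_unit m r (C : 'M[R]_(m, r)) d : d < 1 ->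
  (forall w, (1 - d) * norm2 w ^+ 2 <= norm2 (C *m w) ^+ 2) ->
  C^T *m C \in unitmx.
Proof.
move=> d1 lo; rewrite -row_free_unit; apply: inj_row_free => v vG.
have : norm2 (C *m v^T) ^+ 2 = 0.
  by rewrite norm2_sqr /dot trmx_mul trmxK mulmxA -(mulmxA v) vG mul0mx mxE.
move=> C0; have := lo v^T; rewrite C0 pmulr_rle0 ?subr_gt0 // => v0.
have /eqP : norm2 v^T ^+ 2 == 0 by rewrite eq_le v0 sqr_ge0.
move/eqP; rewrite sqrf_eq0 => /eqP /norm2_eq0 vT.
by rewrite -[v]trmxK vT trmx0.
Qed.

Lemma norm2_trmx m r (C : 'M[R]_(m, r)) b : 0 <= b ->
  (forall w, norm2 (C *m w) <= b * norm2 w) ->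
  forall u, norm2 (C^T *m u) <= b * norm2 u.
Proof.
move=> b0 hi u; set w := C^T *m u.
have [w0|w0] := eqVneq (norm2 w) 0; first by rewrite w0 mulr_ge0 ?norm2_ge0.
have wp : 0 < norm2 w by rewrite lt0r w0 norm2_ge0.
rewrite -(ler_pM2l wp) -expr2 norm2_sqr {2}/w -dot_mulmxl.
apply: le_trans (dot_le _ _) _.
by rewrite mulrA (mulrC (norm2 w)); apply: ler_wpM2r => //; exact: norm2_ge0.
Qed.

(** With [w = (C^T C)^-1 g] the form equals [|C w|^2 = dot g w]. The lower estimate comes from
    [|g| = |C^T (C w)| <= sqrt (1 + d) |C w|]; the upper one from [(1 - d) |w| <= |g|] and
    Cauchy-Schwarz. *)
Lemma gram_inv_bounds m r (C : 'M[R]_(m, r)) d : 0 <= d < 1 ->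
  (forall w, (1 - d) * norm2 w ^+ 2 <= norm2 (C *m w) ^+ 2 <= (1 + d) * norm2 w ^+ 2) ->
  forall g, 1 / (1 + d) * norm2 g ^+ 2 <= dot g (invmx (C^T *m C) *m g)
    <= 1 / (1 - d) * norm2 g ^+ 2.
Proof.
move=> /andP[d0 d1] h g; set w := invmx _ *m g.
have Gw : g = C^T *m (C *m w).
  rewrite /w !mulmxA mulmxV ?mul1mx //; apply: (gram_unit d1) => z.
  by have /andP[] := h z.
have gw : dot g w = norm2 (C *m w) ^+ 2 by rewrite dotC Gw -dot_mulmxl norm2_sqr.
have hi : norm2 g ^+ 2 <= (1 + d) * norm2 (C *m w) ^+ 2.
  have e : Num.sqrt (1 + d) ^+ 2 = 1 + d by rewrite sqr_sqrtr // addr_ge0.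
  rewrite -{1}e -exprMn ler_pXn2r ?nnegrE ?mulr_ge0 ?norm2_ge0 ?sqrtr_ge0 //.
  rewrite Gw; apply: norm2_trmx; first exact: sqrtr_ge0.
  move=> z; apply: norm2_le; first by rewrite mulr_ge0 ?norm2_ge0 ?sqrtr_ge0.
  by rewrite exprMn e; have /andP[] := h z.
have dp : 0 < 1 - d by rewrite subr_gt0.
have lo : (1 - d) * norm2 w <= norm2 g.
  have [w0|w0] := eqVneq (norm2 w) 0; first by rewrite w0 mulr0 norm2_ge0.
  have wp : 0 < norm2 w by rewrite lt0r w0 norm2_ge0.
  rewrite -(ler_pM2r wp) -mulrA -expr2; have /andP[h1 _] := h w.
  by apply: le_trans h1 _; rewrite -gw dot_le.
rewrite gw; apply/andP; split.
  by rewrite mul1r mulrC ler_pdivrMr 1?mulrC // ltr_wpDr.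
rewrite mul1r mulrC ler_pdivlMr // -gw mulrC.
apply: le_trans (_ : norm2 g * ((1 - d) * norm2 w) <= _).
  by rewrite mulrCA ler_pM2l // dot_le.
by rewrite expr2 ler_wpM2l // norm2_ge0.
Qed.

End RestrictedIsometry.

(** * The matrix [M Z] of the Newton direction and its spectral bounds *)

Section NewtonMatrix.
Variable R : realType.
Implicit Types (m n : nat).

Lemma rank_ofP n (O : {set 'I_n}) i :
  match rank_of O i with Some a => enum_val a = i | None => i \notin O end.
Proof.
rewrite /rank_of; case: pickP => [a /eqP //|no]; apply/negP => iO.
by have := no (enum_rank_in iO i); rewrite enum_rankK_in ?eqxx.
Qed.

(** Extension by zero from the coordinates in [O] to the whole space. It is an isometry, and it
    turns the case distinctions in [Mmx] into matrix algebra. *)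
Definition embed n (O : {set 'I_n}) : 'M[R]_(n, #|O|) := cols 1%:M O.

Lemma embedE n (O : {set 'I_n}) i a : embed O i a = (i == enum_val a)%:R.
Proof. by rewrite !mxE. Qed.

Lemma cols_embed m n (A : 'M[R]_(m, n)) O : cols A O = A *m embed O.
Proof. by rewrite mulmx_colsub mulmx1. Qed.

Lemma row_embed n (O : {set 'I_n}) i :
  row i (embed O) = if rank_of O i is Some a then delta_mx 0 a else 0.
Proof.
have := rank_ofP O i; case: (rank_of O i) => [a ai|iO].
  apply/rowP => b; rewrite mxE embedE mxE eqxx /= -ai (inj_eq enum_val_inj).
  by rewrite eq_sym.
apply/rowP => b; rewrite mxE embedE mxE; case: eqP => // ib.
by rewrite ib enum_valP in iO.
Qed.

Lemma embed_conj n (O : {set 'I_n}) (B : 'M[R]_#|O|) i j :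
  (embed O *m B *m (embed O)^T) i j =
  match rank_of O i, rank_of O j with Some a, Some b => B a b | _, _ => 0 end.
Proof.
have -> : (embed O *m B *m (embed O)^T) i j =
    (row i (embed O) *m B *m (row j (embed O))^T) 0 0.
  rewrite -row_mul mxE [RHS]mxE; apply: eq_bigr => b _.
  by rewrite [X in _ = X * _]mxE !mxE.
rewrite !row_embed; case: (rank_of O i) => [a|]; last by rewrite !mul0mx mxE.
case: (rank_of O j) => [b|]; last by rewrite trmx0 mulmx0 mxE.
by rewrite trmx_delta -rowE -colE !mxE.
Qed.

Lemma embed_trmx_mul n (O : {set 'I_n}) : (embed O)^T *m embed O = 1%:M.
Proof.
rewrite [X in _ *m X]/embed /cols mulmx_colsub mulmx1.
apply/matrixP => a b; rewrite mxE mxE embedE mxE (inj_eq enum_val_inj).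
by rewrite eq_sym.
Qed.

Lemma norm2_embed n (O : {set 'I_n}) w : norm2 (embed O *m w) = norm2 w.
Proof.
apply: (@pexpIrn _ 2) => //; rewrite ?nnegrE ?norm2_ge0 //.
by rewrite !norm2_sqr dot_mulmxl mulmxA embed_trmx_mul mul1mx.
Qed.

Lemma supp_embed n (O : {set 'I_n}) w : supp (embed O *m w) \subset O.
Proof.
apply/fintype.subsetP => i; rewrite inE; apply: contraR => iO.
rewrite mxE big1 // => a _; rewrite embedE; case: eqP => [ia|]; last by rewrite mul0r.
by rewrite ia enum_valP in iO.
Qed.

(** With [E = embed O], the matrix [E E^T] is the projection onto the coordinates in [O]. So [M Z]
    acts as the inverse Gram matrix on [O] and as the scalar [alpha * gamma] on the complement. *)
Lemma MZ_embed m n (A : 'M[R]_(m, n)) alpha gamma (O : {set 'I_n}) :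
  Mmx A alpha O *m Zmx gamma O =
  embed O *m invmx ((cols A O)^T *m cols A O) *m (embed O)^T +
  (alpha * gamma) *: (1%:M - embed O *m (embed O)^T).
Proof.
apply/matrixP => i j; rewrite mul_mx_diag mxE.
(* Inserting an identity into [E E^T] lets [embed_conj] compute its entries too, with [B = 1]. *)
rewrite [RHS]mxE embed_conj [X in _ = _ + X]mxE -[X in X *m _^T]mulmx1.
rewrite [X in _ = _ + _ * X]mxE [X in _ = _ + _ * (_ + X)]mxE embed_conj !mxE.
have := rank_ofP O i; have := rank_ofP O j.
case: (rank_of O i) => [a|]; case: (rank_of O j) => [b|].
- move=> <- <-; rewrite enum_valP mulr1 (inj_eq enum_val_inj).
  by rewrite [X in _ * (_ - X)]mxE subrr mulr0 addr0.
- move=> jO ai; rewrite mul0r subr0 add0r; case: eqP => [ij|]; last by rewrite mulr0.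
  by rewrite -ij -ai enum_valP in jO.
- move=> bj iO; rewrite mul0r subr0 add0r; case: eqP => [ij|]; last by rewrite mulr0.
  by rewrite ij -bj enum_valP in iO.
- move=> /negbTE -> _; rewrite add0r subr0.
  by case: eqP; rewrite ?mulr0 ?mul0r ?mulr1.
Qed.

Lemma MZ_sym m n (A : 'M[R]_(m, n)) alpha gamma (O : {set 'I_n}) :
  (Mmx A alpha O *m Zmx gamma O)^T = Mmx A alpha O *m Zmx gamma O.
Proof.
rewrite MZ_embed linearD linearZ linearB /= !trmx_mul !trmxK trmx1 trmx_inv.
by rewrite !trmx_mul !trmxK mulmxA.
Qed.

(** The form splits into the inverse Gram form at [E^T v] and [alpha * gamma] times
    [|v|^2 - |E^T v|^2]. Both parts obey bounds with the same two constants, and these add up. *)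
Lemma MZ_bounds m n (A : 'M[R]_(m, n)) alpha gamma (O : {set 'I_n}) t d :
  rip A t d -> (#|O| <= t)%N ->
  1 / (1 + d) <= alpha * gamma -> alpha * gamma <= 1 / (1 - d) ->
  forall v, 1 / (1 + d) * norm2 v ^+ 2
    <= dot v (Mmx A alpha O *m Zmx gamma O *m v) <= 1 / (1 - d) * norm2 v ^+ 2.
Proof.
move=> [d01 rd] Ot lo hi v; set E := embed O.
have Eh w : norm2 (cols A O *m w) = norm2 (A *m (E *m w)).
  by rewrite cols_embed mulmxA.
have := @gram_inv_bounds R _ _ (cols A O) d d01.
set H := invmx _.
case/(_ _ (E^T *m v))/andP.
  move=> w; rewrite Eh -(norm2_embed w); apply: rd.
  by apply: leq_trans Ot; rewrite subset_leq_card ?supp_embed.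
have -> : dot v (Mmx A alpha O *m Zmx gamma O *m v) =
    dot (E^T *m v) (H *m (E^T *m v)) +
    alpha * gamma * (norm2 v ^+ 2 - norm2 (E^T *m v) ^+ 2).
  rewrite MZ_embed mulmxDl dotDr; congr (_ + _).
    by rewrite -/E -/H dot_mulmxl trmxK !mulmxA.
  rewrite -scalemxAl dotZr mulmxBl mul1mx dotBr -norm2_sqr; congr (_ * (_ - _)).
  by rewrite norm2_sqr dot_mulmxl trmxK mulmxA.
have Ev : norm2 (E^T *m v) <= norm2 v.
  rewrite -[leRHS]mul1r; apply: norm2_trmx => // w.
  by rewrite mul1r norm2_embed.
have : 0 <= norm2 v ^+ 2 - norm2 (E^T *m v) ^+ 2.
  by rewrite subr_ge0 ler_pXn2r ?nnegrE ?norm2_ge0.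
move: (norm2 v ^+ 2) (norm2 (E^T *m v) ^+ 2) => N N' NN h1 h2.
have := ler_wpM2r NN lo; have := ler_wpM2r NN hi.
move=> h3 h4; apply/andP; split; lra.
Qed.

Lemma MZ_norm2 m n (A : 'M[R]_(m, n)) alpha gamma (O : {set 'I_n}) t d :
  rip A t d -> (#|O| <= t)%N ->
  1 / (1 + d) <= alpha * gamma -> alpha * gamma <= 1 / (1 - d) ->
  forall v, norm2 (Mmx A alpha O *m Zmx gamma O *m v) <= 1 / (1 - d) * norm2 v.
Proof.
move=> rd Ot lo hi v; have [/andP[d0 d1] _] := rd.
have b0 : 0 <= 1 / (1 - d) by rewrite divr_ge0 // subr_ge0 ltW.
have a0 : 0 <= 1 / (1 + d) by rewrite divr_ge0 // addr_ge0.
(* Seen as a restriction to the full index set, the vector falls under [sym_form_norm2]. *)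
set P := _ *m Zmx _ _; rewrite -[leLHS](congr1 _ (restr_vec_id (finset.subsetT _))).
apply: sym_form_norm2 (finset.subsetT _) => //; first exact: MZ_sym.
move=> z _; have /andP[h1 h2] := MZ_bounds rd Ot lo hi z.
by rewrite ger0_norm //; apply: le_trans h1; rewrite mulr_ge0 ?sqr_ge0.
Qed.

(** For [0 <= lambda] the form of [1 - lambda P] lies between [1 - lambda / (1 - d)] and
    [1 - lambda / (1 + d)] times [|v|^2]; [Delta] dominates both in absolute value. *)
Lemma MZ_defect m n (A : 'M[R]_(m, n)) lambda alpha gamma (O : {set 'I_n}) t d :
  rip A t d -> (#|O| <= t)%N -> 0 <= lambda ->
  1 / (1 + d) <= alpha * gamma -> alpha * gamma <= 1 / (1 - d) ->
  forall v, norm2 (v - lambda *: (Mmx A alpha O *m Zmx gamma O *m v))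
    <= Delta lambda d * norm2 v.
Proof.
move=> rd Ot l0 lo hi v; set P := _ *m Zmx _ _.
have -> : v - lambda *: (P *m v) = (1%:M - lambda *: P) *m v.
  by rewrite mulmxBl mul1mx scalemxAl.
rewrite -[leLHS](congr1 _ (restr_vec_id (finset.subsetT _))).
apply: sym_form_norm2 (finset.subsetT _) => //.
- by rewrite le_max normr_ge0.
- by rewrite linearB linearZ /= trmx1 MZ_sym.
move=> z _; have /andP[h1 h2] := MZ_bounds rd Ot lo hi z.
rewrite mulmxBl mul1mx -scalemxAl dotBr dotZr -norm2_sqr -/P.
have N0 := sqr_ge0 (norm2 z).
have {}h1 := ler_wpM2l l0 h1; have {}h2 := ler_wpM2l l0 h2.
have D1 : `|1 - lambda / (1 - d)| <= Delta lambda d by rewrite le_max lexx.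
have D2 : `|1 - lambda / (1 + d)| <= Delta lambda d by rewrite le_max lexx orbT.
move: D1 D2; rewrite !ler_norml => /andP[/(ler_wpM2r N0) D1 _].
move=> /andP[_ /(ler_wpM2r N0) D2].
apply/andP; split; lra.
Qed.

End NewtonMatrix.

(** * Hard thresholding and the least-squares step *)

Section Pursuit.
Variable R : realType.
Implicit Types (m n : nat).

(** Summing [F i <= F j] over all pairs gives [|Y| sum_X F <= |X| sum_Y F], and [|X| <= |Y|]. An
    empty [Y] forces an empty [X]. *)
Lemma sum_le_card (I : finType) (F : I -> R) (X Y : {set I}) :
  (#|X| <= #|Y|)%N -> (forall i, 0 <= F i) ->
  (forall i j, i \in X -> j \in Y -> F i <= F j) ->
  \sum_(i in X) F i <= \sum_(j in Y) F j.
Proof.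
move=> XY F0 FXY; have [Y0|Y0] := posnP #|Y|.
  move: XY; rewrite Y0 leqn0 cards_eq0 => /eqP ->; rewrite big_set0.
  exact: sumr_ge0.
have p : 0 < #|Y|%:R :> R by rewrite ltr0n.
rewrite -(ler_pM2l p).
apply: (@le_trans _ _ (#|X|%:R * \sum_(j in Y) F j)); last first.
  by apply: ler_wpM2r; [exact: sumr_ge0 | rewrite ler_nat].
rewrite !mulr_natl -!sumr_const exchange_big /=.
by apply: ler_sum => i iX; apply: ler_sum => j jY; exact: FXY.
Qed.

(** On [S :\: L] write [z] as [(z - u) + u], with parts [a] and [b]. The nonzero entries of [b] were
    rejected by the thresholding, so they are dominated by the entries of [u] on [T1 :\: S], where
    [z] vanishes and [u] is [-(z - u)]: thus [|b| <= |c|]. Since [a] and [c] have disjoint supports,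
    [(|a| + |b|)^2 <= 2 (|a|^2 + |c|^2)] concludes. *)
Lemma thr_tail n (T : nat -> 'cV[R]_n -> {set 'I_n}) k (u z : 'cV[R]_n) :
  topk_rule T -> sparse k z ->
  norm2 (restr_vec (~: Lthr T k u)%SET z) <=
  Num.sqrt 2 * norm2 (restr_vec (supp z :|: T k u)%SET (z - u)).
Proof.
move=> Tk zk; set S := supp z; set L := Lthr T k u; set T1 := T k u.
have [cT hT] := Tk k u; rewrite -/T1 in cT hT.
have LT i : (i \in L) = (i \in T1) && (u i 0 != 0).
  by rewrite inE mxE -/T1; case: ifP => //; rewrite eqxx.
have zS i : i \notin S -> z i 0 = 0 by rewrite inE negbK => /eqP.
have -> : restr_vec (~: L)%SET z = restr_vec (S :\: L)%SET (z - u) + restr_vec (S :\: L)%SET u.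
  rewrite -restr_vecD subrK; apply/colP => i; rewrite !mxE !inE -/L.
  by case: (z i 0 =P 0) => [->|_]; rewrite ?if_same ?andbT.
set a := restr_vec _ (z - u); set b := restr_vec _ u.
set c := restr_vec (T1 :\: S)%SET (z - u).
have ac : norm2 a ^+ 2 + norm2 c ^+ 2 <= norm2 (restr_vec (S :|: T1)%SET (z - u)) ^+ 2.
  rewrite !norm2_restr_sqr [leRHS](bigID (mem S)) /=; apply: lerD.
    rewrite [leRHS](eq_bigl (mem S)) => [|i]; last first.
      by rewrite !inE; case: (_ != 0); rewrite /= ?andbF ?orbT.
    rewrite [leRHS](bigID (mem L)) /= [leRHS]addrC.
    rewrite (eq_bigl (fun i => (i \in S) && (i \notin L))) => [|i]; last by rewrite inE andbC.
    by rewrite lerDl; apply: sumr_ge0 => i _; exact: sqr_ge0.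
  rewrite le_eqVlt; apply/orP; left; apply/eqP; apply: eq_bigl => i.
  by rewrite finset.in_setD finset.in_setU; case: (i \in S); rewrite ?andbF ?andbT.
have bc : norm2 b ^+ 2 <= norm2 c ^+ 2.
  rewrite !norm2_restr_sqr.
  (* [L] may be smaller than [T1], but [u] vanishes on the difference, so only [S :\: T1]
     contributes. *)
  rewrite [X in X <= _](bigID (mem T1)) /= big1 ?add0r; last first.
    move=> i /andP[]; rewrite finset.in_setD LT => /andP[h _] iT.
    by move: h; rewrite iT /= negbK => /eqP ->; rewrite expr0n.
  rewrite (eq_bigl (mem (S :\: T1)%SET)) => [|i]; last first.
    by rewrite finset.in_setD [RHS]finset.in_setD LT; case: (i \in T1); rewrite ?andbF ?andbT.
  rewrite [leRHS](eq_bigr (fun i => u i 0 ^+ 2)) => [|i]; last first.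
    by rewrite finset.in_setD => /andP[iS _]; rewrite !mxE zS // sub0r sqrrN.
  apply: sum_le_card => [|i|i j].
  (* The support of [z] has at most [minn k n] elements, which is the size of [T1]; removing the
     common part preserves the comparison. *)
  - rewrite !cardsD (finset.setIC T1) leq_sub2r // cT leq_min zk.
    by rewrite -[X in (_ <= X)%N]card_ord max_card.
  - exact: sqr_ge0.
  - rewrite !finset.in_setD => /andP[iT _] /andP[_ jT].
    rewrite -[leLHS]real_normK ?num_real // -[leRHS]real_normK ?num_real //.
    by rewrite ler_pXn2r ?nnegrE //; exact: hT.
apply: norm2_le; first by rewrite mulr_ge0 ?sqrtr_ge0 ?norm2_ge0.
rewrite exprMn (sqr_sqrtr (ler0n _ 2)).
have h := norm2D a b; have a0 := norm2_ge0 a; have b0 := norm2_ge0 b.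
have h2 : norm2 (a + b) ^+ 2 <= (norm2 a + norm2 b) ^+ 2.
  by rewrite ler_pXn2r ?nnegrE ?addr_ge0 ?norm2_ge0.
apply: le_trans h2 _; have := sqr_ge0 (norm2 a - norm2 b); lra.
Qed.

(** Normal equations: moving [w] by [t *: h], where [h] is the restricted gradient direction, stays
    admissible, so minimality gives [2 t c <= t^2 N] for every [t], with [c = |h|^2]. *)
Lemma argmin_normal m n (A : 'M[R]_(m, n)) y S w :
  is_argmin_on A y S w -> restr_vec S (A^T *m (y - A *m w)) = 0.
Proof.
move=> [wS wmin]; set r := y - A *m w; set h := restr_vec S _.
apply: norm2_eq0; apply/eqP; rewrite -sqrf_eq0 -dot_restr_norm2 -/h -dot_mulmxl.
set N := norm2 (A *m h) ^+ 2; set c := dot _ _.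
have cE : c = norm2 h ^+ 2 by rewrite /c dot_mulmxl dot_restr_norm2.
have N0 : 0 <= N by exact: sqr_ge0.
have key t : 2 * t * c <= t ^+ 2 * N.
  have := wmin (w + t *: h) (suppD wS (suppZ _ (supp_restr _ _))).
  rewrite mulmxDr -scalemxAr opprD addrA -/r [X in _ <= X]norm2B_sqr dotZl -/c.
  by rewrite norm2Z exprMn real_normK ?num_real // -/N; lra.
have N1 : 0 < N + 1 by rewrite ltr_wpDl.
(* The near-optimal [t] has [N + 1] in the denominator because [N] may be 0. It yields
   [2 c^2 (N + 1) <= c^2 N], hence [c = 0]. *)
have := key (c / (N + 1)); rewrite -(ler_pM2r (exprn_gt0 2 N1)).
have -> : 2 * (c / (N + 1)) * c * (N + 1) ^+ 2 = 2 * c ^+ 2 * (N + 1).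
  by field; rewrite gt_eqF.
have -> : (c / (N + 1)) ^+ 2 * N * (N + 1) ^+ 2 = c ^+ 2 * N.
  by field; rewrite gt_eqF.
move=> k; have cN := mulr_ge0 (sqr_ge0 c) N0.
have : c ^+ 2 <= 0 by lra.
by move=> c0; rewrite -sqrf_eq0 eq_le c0 sqr_ge0.
Qed.

(** Here [E] is the size of an error, [a] and [b] those of its parts on and off the chosen support.
    Inserting the bound on [a] into the Pythagorean identity leaves a quadratic inequality in
    [E]. *)
Lemma quadratic_bound (d E a b s : R) : 0 <= d < 1 -> 0 <= E -> 0 <= a -> 0 <= b -> 0 <= s ->
  E ^+ 2 = a ^+ 2 + b ^+ 2 -> a <= d * E + s ->
  E <= b / Num.sqrt (1 - d ^+ 2) + s / (1 - d).
Proof.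
move=> /andP[d0 d1] E0 a0 b0 s0 Eab aE.
have p : 0 < 1 - d by rewrite subr_gt0.
have q : 0 < 1 - d ^+ 2 by rewrite subr_gt0 expr_lt1.
set g := Num.sqrt _; have g0 : 0 < g by rewrite sqrtr_gt0.
have g2 : g ^+ 2 = 1 - d ^+ 2 by rewrite sqr_sqrtr // ltW.
set X := b / g; set Y := s / (1 - d).
have bX : b = g * X by rewrite /X mulrC divfK // gt_eqF.
have sY : s = (1 - d) * Y by rewrite /Y mulrC divfK // gt_eqF.
have X0 : 0 <= X by rewrite divr_ge0 // ltW.
have Y0 : 0 <= Y by rewrite divr_ge0 // ltW.
rewrite leNgt; apply/negP => XY.
have : E ^+ 2 <= (d * E + s) ^+ 2 + b ^+ 2.
  by rewrite Eab lerD2r ler_pXn2r ?nnegrE // (le_trans a0).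
rewrite bX exprMn g2 sY => h.
(* The contradiction rests on [E^2 - (d E + (1 - d) Y)^2 = (1 - d^2) (E - Y) E + (1 - d)^2 (E - Y)
   Y]. *)
have h1 : X ^+ 2 < (E - Y) * E.
  by rewrite expr2; apply: ltr_pM => //; lra.
have h2 : 0 <= (E - Y) * ((1 - d) ^+ 2 * Y).
  by apply: mulr_ge0; [lra | rewrite mulr_ge0 ?sqr_ge0].
have := h1; rewrite -(ltr_pM2l q) => h3; lra.
Qed.

(** By the normal equations the error [v = z - w] agrees on [S] with [(v - A^T A v) - A^T e], which
    the RIP controls; off [S] it equals [z], as [w] vanishes there. [quadratic_bound] combines the
    two parts. *)
Lemma pursuit_bound m n (A : 'M[R]_(m, n)) k d2 d1 (S : {set 'I_n}) z e w :
  rip A (2 * k) d2 -> rip A k d1 -> sparse k z -> (#|S| <= k)%N ->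
  is_argmin_on A (A *m z + e) S w ->
  norm2 (w - z) <= norm2 (restr_vec (~: S)%SET z) / Num.sqrt (1 - d2 ^+ 2) +
    Num.sqrt (1 + d1) / (1 - d2) * norm2 e.
Proof.
move=> r2 r1 zk Sk wmin; have [wS _] := wmin.
have := argmin_normal wmin; rewrite norm2C; set v := z - w.
have -> : A *m z + e - A *m w = A *m v + e by rewrite mulmxBr addrAC.
move=> v0.
rewrite [X in _ <= _ + X]mulrAC.
apply: (@quadratic_bound d2 _ (norm2 (restr_vec S v))); rewrite ?norm2_ge0 //.
- by case: r2.
- by rewrite mulr_ge0 ?sqrtr_ge0 ?norm2_ge0.
- rewrite (norm2_splitC S v); congr (_ + norm2 _ ^+ 2).
  rewrite restr_vecB (_ : restr_vec _ w = 0) ?subr0 //.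
  apply/colP => i; rewrite !mxE finset.in_setC; case: ifP => //; apply: contraNeq => wi.
  by apply: (fintype.subsetP wS); rewrite inE.
have -> : restr_vec S v = restr_vec S (v - A^T *m (A *m v)) - restr_vec S (A^T *m e).
  rewrite -restr_vecB.
  have -> : v - A^T *m (A *m v) - A^T *m e = v - A^T *m (A *m v + e).
    by rewrite [A^T *m (_ + e)]mulmxDr opprD addrA.
  by rewrite [RHS]restr_vecB v0 subr0.
apply: le_trans (norm2B _ _) (lerD _ _); last exact: rip_trmx r1 Sk.
apply: (rip_defect (O := (supp z :|: S)%SET) r2).
- rewrite (leq_trans (leq_card_setU _ _)) // mul2n -addnn leq_add //.
- by rewrite suppB ?finset.subsetUl // (fintype.subset_trans wS) ?finset.subsetUr.
- exact: finset.subsetUr.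
Qed.

End Pursuit.

(** * One iteration of the algorithm, and convergence of the iterates *)

Section Iteration.
Variable R : realType.

(** With [s = Num.sqrt 5] the square of [golden R] is [(6 + 2 s) / 4], which is at least 2 because
    [1 <= s]. *)
Lemma sqrt2_le_golden : Num.sqrt 2 <= golden R.
Proof.
have s5 : 1 <= Num.sqrt 5 :> R by rewrite -[leLHS]sqrtr1 ler_wsqrtr // ler1n.
have g0 : 0 <= golden R by rewrite /golden; lra.
have e : Num.sqrt 5 ^+ 2 = 5 :> R by rewrite sqr_sqrtr.
rewrite -[leRHS](ger0_norm g0) -sqrtr_sqr; apply: ler_wsqrtr.
by rewrite /golden; move: (Num.sqrt 5) s5 e => s s5 e; nra.
Qed.

Lemma ceil_div_ge0 n k : 0 <= ceil_div R n k.
Proof.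
by rewrite /ceil_div ler0z Num.Theory.ceil_ge0 (lt_le_trans (ltrN10 _)) ?divr_ge0.
Qed.

Lemma card_Lthr n (T : nat -> 'cV[R]_n -> {set 'I_n}) k z :
  topk_rule T -> (#|Lthr T k z| <= k)%N.
Proof.
move=> Tk; apply: (@leq_trans #|T k z|); last by rewrite (Tk k z).1 geq_minl.
by rewrite subset_leq_card ?supp_restr.
Qed.

Lemma cnhtp_step m n k q (T : nat -> 'cV[R]_n -> {set 'I_n}) (A : 'M[R]_(m, n))
    (z : 'cV[R]_n) (e : 'cV[R]_m) (lambda alpha gamma : R) w w' dq dk d2 d3 :
  let c := ceil_div R n k in
  (0 < n)%N -> (0 < k)%N -> topk_rule T ->
  rip A q dq -> rip A k dk -> rip A (2 * k) d2 -> rip A (3 * k) d3 ->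
  0 <= lambda ->
  1 / (1 + dq) <= alpha * gamma -> alpha * gamma <= 1 / (1 - dq) ->
  sparse k z -> sparse k w ->
  is_argmin_on A (A *m z + e)
    (Lthr T k (cnhtp_u T A (A *m z + e) q lambda alpha gamma w)) w' ->
  norm2 (w' - z) <=
    golden R / Num.sqrt (1 - d2 ^+ 2) *
      (d3 + Delta lambda dq * (1 + Num.sqrt c * d3)) * norm2 (w - z) +
    (lambda * golden R / (1 - dq) * Num.sqrt (c * (1 + dk) / (1 - d2 ^+ 2)) +
     Num.sqrt (1 + dk) / (1 - d2)) * norm2 e.
Proof.
move=> c n0 k0 Tk rq r1 r2 r3 l0 lo hi zk wk wmin.
have [/andP[dq0 dq1] _] := rq; have [/andP[dk0 dk1] _] := r1.
have [/andP[d20 d21] _] := r2; have [/andP[d30 d31] _] := r3.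
have c0 : 0 <= c by exact: ceil_div_ge0.
apply: le_trans (pursuit_bound r2 r1 zk (card_Lthr _ _ Tk) wmin) _.
(* The noise term of the least-squares step cancels; what remains is to bound the part of [z] off
   the new support. *)
rewrite [X in _ <= _ + X]mulrDl addrA lerD2r.
set u := cnhtp_u _ _ _ _ _ _ _ _ in wmin *; have {wmin}tail := thr_tail u Tk zk.
set V := (supp z :|: T k u)%SET in tail.
set v := z - w; rewrite (norm2C w) -/v.
set r := A^T *m (A *m z + e - A *m w); set O := Lthr T q r.
set P := Mmx A alpha O *m Zmx gamma O.
have Oq : (#|O| <= q)%N by exact: card_Lthr.
have rE : r = A^T *m (A *m v) + A^T *m e.
  by rewrite /r /v -mulmxDr; congr (_ *m _); rewrite mulmxBr addrAC.
have zu : z - u = (v - A^T *m (A *m v)) +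
    (A^T *m (A *m v) - lambda *: (P *m (A^T *m (A *m v)))) - lambda *: (P *m (A^T *m e)).
  have -> : u = w + lambda *: (P *m r) by [].
  rewrite rE mulmxDr scalerDr /v !opprD !addrA; congr (_ - _ - _).
  by rewrite subrK.
have card_zw : (#|supp z :|: supp w| <= 2 * k)%N.
  by rewrite (leq_trans (leq_card_setU _ _)) // mul2n -addnn leq_add.
have vzw : supp v \subset (supp z :|: supp w)%SET.
  by rewrite suppB ?finset.subsetUl ?finset.subsetUr.
(* The supports of [z] and [w] together with [W] have at most [3 * k] elements. This serves for
   [W = T k u] and for every block of size at most [k]. *)
have defect (W : {set 'I_n}) : (#|W| <= k)%N ->
    norm2 (restr_vec (supp z :|: W)%SET (v - A^T *m (A *m v))) <= d3 * norm2 v.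
  move=> Wk; apply: (rip_defect (O := (supp z :|: supp w :|: W)%SET) r3).
  - by rewrite (leq_trans (leq_card_setU _ _)) // mulSn addnC leq_add.
  - by rewrite (fintype.subset_trans vzw) ?finset.subsetUl.
  - by rewrite finset.setSU ?finset.subsetUl.
set g := Num.sqrt (1 - d2 ^+ 2).
have g0 : 0 < g by rewrite sqrtr_gt0 subr_gt0 expr_lt1.
have full : norm2 (A^T *m (A *m v)) <= (1 + Num.sqrt c * d3) * norm2 v.
  have -> : A^T *m (A *m v) = v - (v - A^T *m (A *m v)) by rewrite subKr.
  apply: le_trans (norm2B _ _) _; rewrite mulrDl mul1r lerD2l -mulrA.
  apply: norm2_blocks => //; first by rewrite mulr_ge0 ?norm2_ge0.
  move=> W Wk; apply: le_trans (defect _ Wk).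
  (* Adding the support of [z] to the block brings it into the form of [defect]. *)
  have -> : restr_vec W (v - A^T *m (A *m v)) =
      restr_vec W (restr_vec (supp z :|: W)%SET (v - A^T *m (A *m v))).
    by apply/colP => i; rewrite !mxE finset.in_setU; case: ifP => //; rewrite orbT.
  exact: norm2_restr_le.
have noise : norm2 (A^T *m e) <= Num.sqrt c * (Num.sqrt (1 + dk) * norm2 e).
  apply: norm2_blocks => //; first by rewrite mulr_ge0 ?sqrtr_ge0 ?norm2_ge0.
  by move=> W Wk; exact: rip_trmx r1 Wk.
have D0 : 0 <= Delta lambda dq by rewrite le_max normr_ge0.
have bound : norm2 (restr_vec V (z - u)) <=
    (d3 + Delta lambda dq * (1 + Num.sqrt c * d3)) * norm2 v +
    lambda / (1 - dq) * (Num.sqrt c * (Num.sqrt (1 + dk) * norm2 e)).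
  rewrite zu restr_vecB restr_vecD.
  apply: le_trans (norm2B _ _) (lerD _ _); last first.
    apply: le_trans (norm2_restr_le _ _) _; rewrite norm2Z ger0_norm // -mulrA.
    apply: ler_wpM2l => //; apply: le_trans (MZ_norm2 rq Oq lo hi _) _.
    by rewrite mul1r; apply: ler_wpM2l => //; rewrite invr_ge0 subr_ge0 ltW.
  rewrite mulrDl; apply: le_trans (norm2D _ _) (lerD _ _).
    by apply: defect; rewrite (Tk k u).1 geq_minl.
  apply: le_trans (norm2_restr_le _ _) _; apply: le_trans (MZ_defect rq Oq l0 lo hi _) _.
  by rewrite -mulrA; exact: ler_wpM2l.
have phi0 : 0 <= golden R by apply: le_trans sqrt2_le_golden; exact: sqrtr_ge0.
have sq : Num.sqrt (c * (1 + dk) / (1 - d2 ^+ 2)) = Num.sqrt c * Num.sqrt (1 + dk) / g.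
  have dkp : 0 <= 1 + dk by rewrite addr_ge0.
  have d2p : 0 <= 1 - d2 ^+ 2 by rewrite subr_ge0 expr_le1 // ltW.
  by rewrite (sqrtrM _ (mulr_ge0 c0 dkp)) (sqrtrV d2p) (sqrtrM _ c0).
rewrite sq ler_pdivrMr //; apply: le_trans tail _.
apply: le_trans (ler_wpM2r (norm2_ge0 _) sqrt2_le_golden) _.
apply: le_trans (ler_wpM2l phi0 bound) _.
rewrite le_eqVlt; apply/orP; left; apply/eqP; field.
by rewrite !gt_eqF // subr_gt0.
Qed.

Lemma norm2_geometric_cvg n (xs : nat -> 'cV[R]_n) z rho : 0 <= rho < 1 ->
  (forall p, norm2 (xs p.+1 - z) <= rho * norm2 (xs p - z)) ->
  xs p @[p --> \oo] --> z.
Proof.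
move=> /andP[r0 r1] step.
have geo p : norm2 (xs p - z) <= norm2 (xs 0%N - z) * rho ^+ p.
  elim: p => [|p IH]; first by rewrite expr0 mulr1.
  by apply: le_trans (step p) _; rewrite exprS mulrCA ler_wpM2l.
have g0 : norm2 (xs 0%N - z) * rho ^+ p @[p --> \oo] --> (0 : R).
  by apply: cvg_geometric; rewrite ger0_norm.
(* Convergence of matrices is entrywise here, and [norm2] dominates each entry. *)
apply/cvg_ballP => eps eps0; near=> p; split=> // i j; rewrite (ord1 j).
have h : norm2 (xs 0%N - z) * rho ^+ p < eps.
  by near: p; exact: (cvgr_lt _ g0).
rewrite -ball_normE /ball_ /= (le_lt_trans _ h) // (le_trans _ (geo p)) // norm2C.
by apply: le_trans (coord_norm2 _ i); rewrite !mxE.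
Unshelve. all: by end_near.
Qed.

End Iteration.

Theorem theorem3p6 (R : realType) (m n k q : nat)
    (T : nat -> 'cV[R]_n -> {set 'I_n})
    (A : 'M[R]_(m, n)) (x : 'cV[R]_n) (eta y : 'cV[R]_m)
    (lambda alpha gamma : R) (xs : nat -> 'cV[R]_n) :
  let phi : R := golden R in
  let c : R := ceil_div R n k in
  let dq := ric A q in
  let dk := ric A k in
  let d2k := ric A (2 * k)%N in
  let d3k := ric A (3 * k)%N in
  let S := Lthr T k x in
  let xS := restr_vec S x in
  let eta' := A *m restr_vec (~: S)%SET x + eta in
  let tau := (1 / phi * Num.sqrt (1 - d2k ^+ 2) - d3k) / (1 + Num.sqrt c * d3k) in
  let rho2 := phi / Num.sqrt (1 - d2k ^+ 2) *
    (d3k + Delta lambda dq * (1 + Num.sqrt c * d3k)) in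
  (m < n)%N ->
  (0 < k)%N ->
  (k <= q)%N ->
  topk_rule T ->
  y = A *m x + eta ->
  (exists d, is_ric A (maxn q (3 * k)) d) ->
  ric A (maxn q (3 * k)) <
    (- (2 * phi + 1) +
       Num.sqrt ((2 * phi + 1) ^+ 2 + 4 * phi * Num.sqrt c)) /
    (2 * phi * Num.sqrt c) ->
  (1 + dq) * (1 - tau) < lambda ->
  lambda < (1 - dq) * (1 + tau) ->
  0 < alpha ->
  0 < gamma ->
  1 / (1 + dq) <= alpha * gamma ->
  alpha * gamma <= 1 / (1 - dq) ->
  cnhtp T A y k q lambda alpha gamma xs ->
  (forall p : nat,
     norm2 (xs p.+1 - xS) <=
       rho2 * norm2 (xs p - xS) +
       (lambda * phi / (1 - dq) *
          Num.sqrt (c * (1 + dk) / (1 - d2k ^+ 2)) +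
        Num.sqrt (1 + dk) / (1 - d2k)) * norm2 eta') /\
  rho2 < 1 /\
  (eta' = 0 -> xs p @[p --> \oo] --> xS).
Proof.
move=> phi c dq dk d2k d3k S xS eta' tau rho2 mn k0 kq Tk yE [d0 [rmax _]] _.
move=> ltl ltr a0 g0 lo hi [x0 it].
(* Existence of the constant of the largest order gives the RIP at all smaller orders, so none of
   the constants below is the default value of [ric]. *)
have ric_max t : (t <= maxn q (3 * k))%N -> rip A t (ric A t).
  by move=> tm; apply: ricP; exists d0; exact: rip_le rmax.
have rq : rip A q dq by apply: ric_max; lia.
have rk : rip A k dk by apply: ric_max; lia.
have r2 : rip A (2 * k) d2k by apply: ric_max; lia.
have r3 : rip A (3 * k) d3k by apply: ric_max; lia.
have [/andP[dq0 dq1] _] := rq.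
have [/andP[d20 d21] _] := r2; have [/andP[d30 d31] _] := r3.
have c0 : 0 <= c by exact: ceil_div_ge0.
have phi1 : 1 < phi.
  by apply: lt_le_trans (sqrt2_le_golden R); rewrite -[ltLHS]sqrtr1 ltr_sqrt // ltr1n.
pose g := Num.sqrt (1 - d2k ^+ 2).
have gg : 0 < g by rewrite sqrtr_gt0 subr_gt0 expr_lt1.
have h0 : 0 < 1 + Num.sqrt c * d3k by rewrite ltr_wpDr // mulr_ge0 ?sqrtr_ge0.
(* The two ends of the range of [lambda] are in strict order exactly when [dq < tau]. *)
have tau_gt : dq < tau by move: (lt_trans ltl ltr); lra.
(* This makes the lower end of the range nonnegative, hence [lambda] positive. *)
have tau1 : tau <= 1.
  rewrite /tau -/g ler_pdivrMr // mul1r.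
  have : 1 / phi * g <= 1.
    rewrite mul1r mulrC ler_pdivrMr ?mul1r ?(lt_trans ltr01) //.
    apply: le_trans (ltW phi1); rewrite -sqrtr1; apply: ler_wsqrtr.
    by rewrite lerBlDr lerDl sqr_ge0.
  have : 0 <= Num.sqrt c * d3k by rewrite mulr_ge0 ?sqrtr_ge0.
  by lra.
have l0 : 0 < lambda by apply: le_lt_trans ltl; rewrite mulr_ge0 //; lra.
(* [e1] and [e4] restate the range of [lambda]; [e2] and [e3] follow from them since
   [1 - dq <= 1 + dq] and [tau] lies between 0 and 1. *)
have D_tau : Delta lambda dq < tau.
  have dqp : 0 < 1 - dq by lra.
  have dqs : 0 < 1 + dq by lra.
  have t0 : 0 <= dq * tau by apply: mulr_ge0; lra.
  have e1 : lambda / (1 - dq) < 1 + tau by rewrite ltr_pdivrMr // mulrC.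
  have e2 : 1 - tau < lambda / (1 - dq) by rewrite ltr_pdivlMr //; nra.
  have e3 : lambda / (1 + dq) < 1 + tau by rewrite ltr_pdivrMr //; nra.
  have e4 : 1 - tau < lambda / (1 + dq) by rewrite ltr_pdivlMr // mulrC.
  by rewrite /Delta gt_max !ltr_norml; apply/andP; split; apply/andP; split; lra.
have D0 : 0 <= Delta lambda dq by rewrite le_max normr_ge0.
have rho_lt1 : rho2 < 1.
  have -> : rho2 = (d3k + Delta lambda dq * (1 + Num.sqrt c * d3k)) * phi / g.
    by rewrite /rho2 -/g mulrAC (mulrC phi).
  rewrite ltr_pdivrMr // mul1r -ltr_pdivlMr ?(lt_trans ltr01) //.
  by move: D_tau; rewrite /tau -/g (ltr_pdivlMr _ _ h0) div1r (mulrC _ g) ltrBrDl.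
have rho_ge0 : 0 <= rho2.
  apply: mulr_ge0; last by rewrite addr_ge0 // mulr_ge0 // ltW.
  by rewrite divr_ge0 ?ltW // (lt_trans ltr01).
(* The tail of [x] is absorbed into the noise, so [y] becomes a measurement of the sparse target
   [xS]. *)
have yS : y = A *m xS + eta'.
  rewrite yE /eta' addrA -mulmxDr; congr (A *m _ + _).
  apply/colP => i; rewrite !mxE finset.in_setC.
  by case: (i \in S); rewrite ?addr0 ?add0r.
have xSk : sparse k xS.
  by apply: leq_trans (card_Lthr k x Tk); rewrite subset_leq_card ?supp_restr.
have xsk p : sparse k (xs p).
  case: p => [|p].
    rewrite x0 /sparse (_ : supp 0 = finset.set0) ?cards0 //.
    by apply/setP => i; rewrite inE mxE eqxx finset.in_set0.
  have [sub _] := it p.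
  exact: leq_trans (subset_leq_card sub) (card_Lthr _ _ Tk).
have n0 : (0 < n)%N by exact: leq_ltn_trans mn.
have step p := cnhtp_step n0 k0 Tk rq rk r2 r3 (ltW l0) lo hi xSk (xsk p).
have {}step p : norm2 (xs p.+1 - xS) <=
       rho2 * norm2 (xs p - xS) +
       (lambda * phi / (1 - dq) *
          Num.sqrt (c * (1 + dk) / (1 - d2k ^+ 2)) +
        Num.sqrt (1 + dk) / (1 - d2k)) * norm2 eta'.
  by apply: step; rewrite -yS; exact: it.
split => //; split => // e0; apply: (@norm2_geometric_cvg _ _ _ _ rho2).
  by rewrite rho_ge0.
move=> p; apply: le_trans (step p) _.
have -> : norm2 eta' = 0.
  by apply/eqP; rewrite -sqrf_eq0 norm2_sqr e0 dot0l.
by rewrite mulr0 addr0.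
Qed.
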